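(* Consider the following map $X\mapsto P$ for integers $N,D,d\ge 1$ (number of tokens, embedding dimension, degree). Given parameters $A_i\in\mathbb{R}^{N\times N}$, $B_i\in\mathbb{R}^{D\times D}$ ($1\le i\le d$), $C_i\in\mathbb{R}^{N\times N}$, $D_i\in\mathbb{R}^{D\times D}$ ($1\le i\le d-1$), $W\in\mathbb{R}^{N\times D\times d}$, $L\in\mathbb{R}^{N\times D}$, and an input $X\in\mathbb{R}^{N\times D}$, set $Y_i=A_iXB_i$, $Z_1=Y_1$, $Z_{i+1}=(C_iZ_iD_i)\odot Y_{i+1}$, and $[P]_{m,n}=\sum_{i=1}^d [W]_{m,n,i}[Z_i]_{m,n}+[L]_{m,n}$. Assume the matrices $A_i,B_i,C_i,D_i$ are structured in the sense that, for an absolute constant $c$, each $n\times n$ matrix among them (with $n=N$ or $n=D$) is described by at most $c\,n$ parameters and its product (from the left or the right) with a vector of length $n$ can be computed with at most $c\,n$ floating point operations. Then the total number of parameters is $\mathcal{O}(N\cdot D\cdot d)$, and $P$ can be computed from $X$ with $\mathcal{O}(N\cdot D\cdot d)$ floating point operations, where the implied constants depend only on $c$. In particular, for fixed $d$ both are linear in the size $ND$ of the input.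
   Context: $\odot$ is the Hadamard (entrywise) product. A floating point operation is a single real addition or multiplication. The number of parameters counts the parameters describing all the matrices $A_i,B_i,C_i,D_i$, plus the entries of $W$ and $L$. *)

(* Defs.v *)
From mathcomp Require Import all_boot all_order all_algebra.
From mathcomp Require Import reals.

Set Implicit Arguments.
Unset Strict Implicit.
Unset Printing Implicit Defensive.

Import Order.TTheory GRing.Theory Num.Theory.
Local Open Scope ring_scope.

(* Straight-line programs over R whose input is an m x n matrix (a vector being
   a matrix with one column or one row). Each instruction is one floating point
   operation and appends its value to the list of computed values; [Temp k] reads
   the k-th of these. Reading an input, a constant or a computed value is free.
   A [Temp] that points past the values computed so far reads 0. *)
Inductive operand (R : Type) (m n : nat) :=
  | Const of R
  | Input of 'I_m & 'I_n
  | Temp of nat.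

Inductive instr (R : Type) (m n : nat) :=
  | Add of operand R m n & operand R m n
  | Mul of operand R m n & operand R m n.

Record program (R : Type) (m n p q : nat) := Program {
  code : seq (instr R m n);
  output : 'I_p -> 'I_q -> operand R m n
}.

Definition flops (R : Type) (m n p q : nat) (pr : program R m n p q) : nat :=
  size (code pr).

Section Eval.
Variables (R : nzRingType) (m n : nat) (x : 'M[R]_(m, n)).

Definition read (t : seq R) (o : operand R m n) : R :=
  match o with
  | Const a => a
  | Input i j => x i j
  | Temp k => nth 0 t k
  end.

Definition exec (t : seq R) (ins : instr R m n) : R :=
  match ins with
  | Add a b => read t a + read t b
  | Mul a b => read t a * read t b
  end.

Definition run (s : seq (instr R m n)) : seq R :=
  foldl (fun t ins => rcons t (exec t ins)) [::] s.

Definition eval (p q : nat) (pr : program R m n p q) : 'M[R]_(p, q) :=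
  \matrix_(i, j) read (run (code pr)) (output pr i j).

End Eval.

Definition computable_within (R : realType) (m n p q : nat)
    (f : 'M[R]_(m, n) -> 'M[R]_(p, q)) (b : R) : Prop :=
  exists pr : program R m n p q,
    (flops pr)%:R <= b /\ forall x, eval x pr = f x.

(* The number of parameters is a property of a parametrized class of matrices,
   not of a single matrix: [decode] is the map from parameter vectors to the
   matrices that they describe. *)
Record mxfamily (R : realType) (n : nat) := MxFamily {
  nparams : nat;
  decode : 'rV[R]_nparams -> 'M[R]_n
}.

Definition structured (R : realType) (c : R) (n : nat) (F : mxfamily R n) : Prop :=
  (nparams F)%:R <= c * n%:R /\
  forall theta : 'rV[R]_(nparams F),
    computable_within (fun v : 'cV[R]_n => decode theta *m v) (c * n%:R) /\
    computable_within (fun v : 'rV[R]_n => v *m decode theta) (c * n%:R).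

Definition hadamard (R : realType) (m n : nat) (A B : 'M[R]_(m, n)) : 'M[R]_(m, n) :=
  map2_mx *%R A B.

(* Indices start at 0: [A i] is the matrix A_(i+1) of the 1-based convention,
   and likewise for B, C, E, Y, Z and W. Since D is the embedding dimension, E
   stands for the matrices D_1, ..., D_(d-1). *)
Section Map.
Variables (R : realType) (N D d : nat).
Variables (A : 'I_d -> 'M[R]_N) (B : 'I_d -> 'M[R]_D).
Variables (C : 'I_d.-1 -> 'M[R]_N) (E : 'I_d.-1 -> 'M[R]_D).
Variables (W : 'I_N -> 'I_D -> 'I_d -> R) (L : 'M[R]_(N, D)).
Variable X : 'M[R]_(N, D).

Definition Ymx (i : 'I_d) : 'M[R]_(N, D) := A i *m X *m B i.

Fixpoint Zrec (i : nat) : (i < d)%N -> 'M[R]_(N, D) :=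
  match i with
  | 0%N => fun lt_0d => Ymx (Ordinal lt_0d)
  | k.+1 => fun lt_k1d =>
      let k' : 'I_d.-1 := Ordinal (etrans (ltn_predRL k d) lt_k1d) in
      hadamard (C k' *m Zrec (ltnW lt_k1d) *m E k') (Ymx (Ordinal lt_k1d))
  end.

Definition Zmx (i : 'I_d) : 'M[R]_(N, D) := Zrec (ltn_ord i).

Definition Pmx : 'M[R]_(N, D) :=
  \matrix_(m, n) (\sum_(i < d) W m n i * Zmx i m n + L m n).

End Map.

Record architecture (R : realType) (N D d : nat) := Architecture {
  famA : 'I_d -> mxfamily R N;
  famB : 'I_d -> mxfamily R D;
  famC : 'I_d.-1 -> mxfamily R N;
  famD : 'I_d.-1 -> mxfamily R D
}.

Definition structured_architecture (R : realType) (c : R) (N D d : nat)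
    (a : architecture R N D d) : Prop :=
  [/\ forall i, structured c (famA a i),
      forall i, structured c (famB a i),
      forall i, structured c (famC a i) &
      forall i, structured c (famD a i)].

Record parameters (R : realType) (N D d : nat) (a : architecture R N D d) := Weights {
  parA : forall i, 'rV[R]_(nparams (famA a i));
  parB : forall i, 'rV[R]_(nparams (famB a i));
  parC : forall i, 'rV[R]_(nparams (famC a i));
  parD : forall i, 'rV[R]_(nparams (famD a i));
  parW : 'I_N -> 'I_D -> 'I_d -> R;
  parL : 'M[R]_(N, D)
}.

Definition num_parameters (R : realType) (N D d : nat)
    (a : architecture R N D d) : nat :=
  (\sum_(i < d) nparams (famA a i) + \sum_(i < d) nparams (famB a i)
   + \sum_(i < d.-1) nparams (famC a i) + \sum_(i < d.-1) nparams (famD a i)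
   + N * D * d + N * D)%N.

Definition network_map (R : realType) (N D d : nat) (a : architecture R N D d)
    (th : parameters a) (X : 'M[R]_(N, D)) : 'M[R]_(N, D) :=
  Pmx (fun i => decode (parA th i)) (fun i => decode (parB th i))
      (fun i => decode (parC th i)) (fun i => decode (parD th i))
      (parW th) (parL th) X.

(* Main.v *)
(* Multiplying an N x D matrix by a structured matrix costs cND operations,
   column by column on the left (D products of cost cN) and row by row on the
   right (N products of cost cD). All the Y_i then cost 2cNDd, the Z_i cost at
   most (2c + 1)NDd more (the 1 is the Hadamard product), and the weighted sum
   2NDd: altogether (4c + 3)NDd. The same constant bounds the parameters, which
   number at most 4cNDd + NDd + ND. *)
Require Import Defs.
From mathcomp Require Import all_boot all_order all_algebra.
From mathcomp Require Import reals.
From mathcomp Require Import ring lra.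

Import Order.TTheory GRing.Theory Num.Theory.
Local Open Scope ring_scope.

Set Implicit Arguments.
Unset Strict Implicit.
Unset Printing Implicit Defensive.

(** * Straight-line code and its extensions *)

Section Programs.
Variables (R : nzRingType) (m n : nat).
Implicit Types (x : 'M[R]_(m, n)) (s t u : seq (instr R m n)) (o : operand R m n).

Lemma run_rcons x s i : run x (rcons s i) = rcons (run x s) (exec x (run x s) i).
Proof. by rewrite /run foldl_rcons. Qed.

Lemma size_run x s : size (run x s) = size s.
Proof. by elim/last_ind: s => [//|s i IHs]; rewrite run_rcons !size_rcons IHs. Qed.

Lemma run_cat x s t : exists r, run x (s ++ t) = run x s ++ r.
Proof.
elim/last_ind: t => [|t i [r IHt]]; first by exists [::]; rewrite !cats0.
by exists (rcons r (exec x (run x (s ++ t)) i)); rewrite -rcons_cat run_rcons IHt rcons_cat.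
Qed.

Definition in_range (k : nat) o : bool := if o is Temp l then (l < k)%N else true.

Lemma read_cat x (r r' : seq R) o :
  in_range (size r) o -> read x (r ++ r') o = read x r o.
Proof. by case: o => //= l lt_lr; rewrite nth_cat lt_lr. Qed.

(** The operand is fixed before [x], so one program serves all inputs. The range condition makes
    availability survive extension: a dangling [Temp] reads 0 now but may read a later value once
    code is appended. *)
Definition available s (f : 'M[R]_(m, n) -> R) : Prop :=
  exists2 o, in_range (size s) o & forall x, read x (run x s) o = f x.

Definition mx_available (p q : nat) s (f : 'M[R]_(m, n) -> 'M[R]_(p, q)) : Prop :=
  forall i j, available s (fun x => f x i j).

Lemma available_cat s t f : available s f -> available (s ++ t) f.
Proof.
case=> o os of_; exists o => [|x].
  by case: o os {of_} => //= l lt_ls; rewrite size_cat ltn_addr.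
by have [r ->] := run_cat x s t; rewrite read_cat ?of_ // size_run.
Qed.

Lemma mx_available_cat p q s t (f : 'M[R]_(m, n) -> 'M[R]_(p, q)) :
  mx_available s f -> mx_available (s ++ t) f.
Proof. by move=> sf i j; apply: available_cat. Qed.

(** Finite choice, over columns and then over rows, yields one operand table; it serves as the
    output map of a program or as the input wiring of a subroutine. *)
Lemma mx_available_outputs p q s (f : 'M[R]_(m, n) -> 'M[R]_(p, q)) :
  mx_available s f ->
  exists sigma : 'I_p -> 'I_q -> operand R m n, forall i j,
    in_range (size s) (sigma i j) /\
    forall x, read x (run x s) (sigma i j) = f x i j.
Proof.
move=> sf; suff row_outputs i : exists sigma : 'I_q -> operand R m n, forall j,
    in_range (size s) (sigma j) /\ forall x, read x (run x s) (sigma j) = f x i j.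
  by have [sigma] := fin_all_exists row_outputs; exists sigma.
suff entry_output j : exists o,
    in_range (size s) o /\ forall x, read x (run x s) o = f x i j.
  by have [sigma] := fin_all_exists entry_output; exists sigma.
by have [o os of_] := sf i j; exists o.
Qed.

Lemma available_const s a : available s (fun=> a).
Proof. by exists (Const m n a). Qed.

Lemma available_input s i j : available s (fun x => x i j).
Proof. by exists (Input R i j). Qed.

Lemma available_last s (i : instr R m n) :
  available (rcons s i) (fun x => exec x (run x s) i).
Proof.
exists (Temp R m n (size s)) => [|x] /=; first by rewrite size_rcons.
by rewrite run_rcons nth_rcons size_run ltnn eqxx.
Qed.

Lemma available_ext s f g : f =1 g -> available s f -> available s g.
Proof. by move=> fg [o os of_]; exists o => // x; rewrite of_. Qed.

End Programs.

(** * Running a program as a subroutine of another *)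

Section Inlining.
Variables (R : nzRingType) (m n m' n' : nat) (sigma : 'I_m' -> 'I_n' -> operand R m n) (k : nat).

(* An out-of-range [Temp] reads 0 in the subprogram but could be in range after
   shifting, hence the explicit constant 0. *)
Definition inline_operand (j : nat) (o : operand R m' n') : operand R m n :=
  match o with
  | Const a => Const m n a
  | Input i l => sigma i l
  | Temp l => if (l < j)%N then Temp R m n (k + l) else Const m n 0
  end.

Definition inline_instr (j : nat) (i : instr R m' n') : instr R m n :=
  match i with
  | Add a b => Add (inline_operand j a) (inline_operand j b)
  | Mul a b => Mul (inline_operand j a) (inline_operand j b)
  end.

(** The fold hands each instruction the number of those already translated, which is how many
    temporaries its original could see. *)
Definition inline (s : seq (instr R m' n')) : seq (instr R m n) :=
  foldl (fun t i => rcons t (inline_instr (size t) i)) [::] s.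

Lemma inline_rcons (s : seq (instr R m' n')) i :
  inline (rcons s i) = rcons (inline s) (inline_instr (size (inline s)) i).
Proof. by rewrite /inline foldl_rcons. Qed.

Lemma size_inline (s : seq (instr R m' n')) : size (inline s) = size s.
Proof. by elim/last_ind: s => [//|s i IHs]; rewrite inline_rcons !size_rcons IHs. Qed.

Hypothesis sigmak : forall i j, in_range k (sigma i j).

Lemma in_range_inline j (o : operand R m' n') : in_range (k + j) (inline_operand j o).
Proof.
case: o => [//|i l|l] /=; last by case: ifP => //= lt_lj; rewrite ltn_add2l.
by have := sigmak i l; case: (sigma i l) => //= h /ltn_addr->.
Qed.

Variables (x : 'M[R]_(m, n)) (r0 : seq R).
Hypothesis size_r0 : size r0 = k.
Let y : 'M_(m', n') := \matrix_(i, j) read x r0 (sigma i j).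

Lemma read_inline r (o : operand R m' n') :
  read x (r0 ++ r) (inline_operand (size r) o) = read y r o.
Proof.
case: o => [//|i l|l] /=; first by rewrite read_cat ?size_r0 // mxE.
case: ltnP => [_|le_rl] /=; last by rewrite nth_default.
by rewrite nth_cat size_r0 ltnNge leq_addr addKn.
Qed.

(** Here [y] is the input that the wiring [sigma] presents to the subprogram. Every translated
    instruction reproduces the original value on [y], stored behind the values [r0] of the host. *)
Lemma run_inline s0 (s : seq (instr R m' n')) :
  run x s0 = r0 -> run x (s0 ++ inline s) = r0 ++ run y s.
Proof.
move=> s0r0; elim/last_ind: s => [|s i IHs]; first by rewrite !cats0.
rewrite inline_rcons -rcons_cat !run_rcons IHs rcons_cat size_inline.
by rewrite -(size_run y s); case: i => a b /=; rewrite !read_inline.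
Qed.

End Inlining.

(** * Cost of extending a program *)

Section Cost.
Variables (R : realType) (m n : nat).
Implicit Types (s t u : seq (instr R m n)) (P Q : seq (instr R m n) -> Prop).

(** Only the appended instructions are charged, so costs add up under sequencing and values already
    computed are shared for free. *)
Definition reachable (b : R) P s : Prop :=
  exists u, (size u)%:R <= b /\ P (s ++ u).

Definition persistent P : Prop := forall s t, P s -> P (s ++ t).

Lemma reachable_refl P s : P s -> reachable 0 P s.
Proof. by move=> Ps; exists [::]; rewrite cats0. Qed.

Lemma reachable_bind b b' P Q s :
  reachable b P s -> (forall u, P (s ++ u) -> reachable b' Q (s ++ u)) ->
  reachable (b + b') Q s.
Proof.
case=> u [ub Pu] PQ; have [v [vb Qv]] := PQ _ Pu; exists (u ++ v).
by rewrite size_cat natrD lerD // catA.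
Qed.

Lemma reachable_le b b' P s : b <= b' -> reachable b P s -> reachable b' P s.
Proof. by move=> le_bb [u [ub Pu]]; exists u; split; first exact: le_trans le_bb. Qed.

Lemma reachable_impl b P Q s :
  (forall t, P t -> Q t) -> reachable b P s -> reachable b Q s.
Proof. by move=> PQ [u [ub /PQ Qu]]; exists u. Qed.

(** The goals are met one after the other: each is reachable from any extension of [s], and
    persistence keeps those already met. *)
Lemma reachable_forall (I : finType) b (P : I -> seq (instr R m n) -> Prop) s :
  (forall i, persistent (P i)) ->
  (forall i u, reachable b (P i) (s ++ u)) ->
  reachable (#|I|%:R * b) (fun t => forall i, P i t) s.
Proof.
move=> persP reachP.
suff: reachable ((size (enum I))%:R * b)
        (fun t => forall i, i \in enum I -> P i t) s.
  rewrite -cardE; apply: reachable_impl => t Pt i.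
  by apply: Pt; rewrite mem_enum.
elim: (enum I) => [|i r IHr] /=; first by rewrite mul0r; apply: reachable_refl.
rewrite -natr1 mulrDl mul1r; apply: reachable_bind IHr _ => u Pr.
have [v [vb Pv]] := reachP i u; exists v; split=> // j.
by rewrite inE => /predU1P[->//|/Pr]; apply: persP.
Qed.

(** The program for [g] is inlined with its inputs wired to the operands holding the entries of [f];
    inlining preserves length, hence the same bound [b]. *)
Lemma reachable_comp p q p' q' (g : 'M[R]_(p, q) -> 'M[R]_(p', q')) b
    (f : 'M[R]_(m, n) -> 'M[R]_(p, q)) s :
  computable_within g b -> mx_available s f ->
  reachable b (fun t => mx_available t (g \o f)) s.
Proof.
case=> pr [prb evalg] sf.
have [sigma sigmaP] := mx_available_outputs sf.
exists (inline sigma (size s) (code pr)); split; first by rewrite size_inline.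
have sigmas i j := (sigmaP i j).1.
move=> i j; exists (inline_operand sigma (size s) (size (code pr)) (output pr i j)) => [|x].
  by rewrite size_cat size_inline in_range_inline.
have outE : \matrix_(h, l) read x (run x s) (sigma h l) = f x.
  by apply/matrixP=> h l; rewrite mxE; case: (sigmaP h l) => _ ->.
rewrite (run_inline sigmas (size_run x s) _ (erefl _)).
(* [read_inline] expects the cutoff for temporaries as the length of the list of values of the
   subprogram. *)
rewrite -[size (code pr)](size_run (f x)) outE (read_inline sigmas _ (size_run x s)).
by rewrite outE /= -evalg mxE.
Qed.

Lemma reachable_add (f g : 'M[R]_(m, n) -> R) s :
  available s f -> available s g ->
  reachable 1 (fun t => available t (fun x => f x + g x)) s.
Proof.
move=> [o _ of_] [o' _ o'g]; exists [:: Add o o']; split=> //.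
rewrite cats1; apply: available_ext (available_last _ _) => x /=.
by rewrite of_ o'g.
Qed.

Lemma reachable_mul (f g : 'M[R]_(m, n) -> R) s :
  available s f -> available s g ->
  reachable 1 (fun t => available t (fun x => f x * g x)) s.
Proof.
move=> [o _ of_] [o' _ o'g]; exists [:: Mul o o']; split=> //.
rewrite cats1; apply: available_ext (available_last _ _) => x /=.
by rewrite of_ o'g.
Qed.

Lemma reachable_mulmxl p q (M : 'M[R]_p) b (f : 'M[R]_(m, n) -> 'M[R]_(p, q)) s :
  computable_within (fun v : 'cV[R]_p => M *m v) b -> mx_available s f ->
  reachable (q%:R * b) (fun t => mx_available t (fun x => M *m f x)) s.
Proof.
move=> Mb sf; rewrite -[q in q%:R]card_ord.
apply: (@reachable_impl _
  (fun t => forall j, mx_available t (fun x => M *m col j (f x)))).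
  move=> t tM i j; apply: available_ext (tM j i 0) => x.
  by rewrite colE mulmxA -colE mxE.
apply: reachable_forall => [j t u|j u]; first exact: mx_available_cat.
apply: (reachable_comp (f := fun x => col j (f x)) Mb) => i k.
by apply: available_cat; apply: available_ext (sf i j) => x; rewrite mxE.
Qed.

Lemma reachable_mulmxr p q (M : 'M[R]_q) b (f : 'M[R]_(m, n) -> 'M[R]_(p, q)) s :
  computable_within (fun v : 'rV[R]_q => v *m M) b -> mx_available s f ->
  reachable (p%:R * b) (fun t => mx_available t (fun x => f x *m M)) s.
Proof.
move=> Mb sf; rewrite -[p in p%:R]card_ord.
apply: (@reachable_impl _
  (fun t => forall i, mx_available t (fun x => row i (f x) *m M))).
  move=> t tM i j; apply: available_ext (tM i 0 j) => x.
  by rewrite -row_mul mxE.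
apply: reachable_forall => [j t u|i u]; first exact: mx_available_cat.
apply: (reachable_comp (f := fun x => row i (f x)) Mb) => k j.
by apply: available_cat; apply: available_ext (sf i j) => x; rewrite mxE.
Qed.

Lemma reachable_entrywise p q b (f : 'M[R]_(m, n) -> 'M[R]_(p, q)) s :
  (forall i j u, reachable b (fun t => available t (fun x => f x i j)) (s ++ u)) ->
  reachable ((p * q)%:R * b) (fun t => mx_available t f) s.
Proof.
move=> sf.
apply: (@reachable_impl _
  (fun t => forall ij, available t (fun x => f x ij.1 ij.2))).
  by move=> t tf i j; apply: (tf (i, j)).
rewrite -[p in (p * _)%N]card_ord -[q in (_ * q)%N]card_ord -card_prod.
by apply: reachable_forall => [ij t u|ij u]; [apply: available_cat | apply: sf].
Qed.

(** The accumulator starts at the constant [l], which is free; each term then costs one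
    multiplication and one addition. *)
Lemma reachable_affine (I : Type) (r : seq I) (w : I -> R)
    (f : I -> 'M[R]_(m, n) -> R) (l : R) s :
  (forall i, available s (f i)) ->
  reachable (2 * (size r)%:R)
    (fun t => available t (fun x => \sum_(i <- r) w i * f i x + l)) s.
Proof.
move=> sf; elim: r => [|i r IHr] /=.
  rewrite mulr0; apply: reachable_refl; apply: available_ext (available_const _ l).
  by move=> x; rewrite big_nil add0r.
rewrite (_ : 2 * _ = 2 * (size r)%:R + (1 + 1)); last by rewrite -natr1; ring.
apply: reachable_bind IHr _ => u su.
apply: (reachable_bind (reachable_mul (available_const _ (w i)) (available_cat u (sf i)))).
move=> v sv; apply: reachable_impl (reachable_add sv (available_cat v su)) => t.
by apply: available_ext => x; rewrite big_cons addrA.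
Qed.

End Cost.

(** * Cost of the network map *)

Section Network.
Variables (R : realType) (c : R) (N D d : nat).
Variables (A : 'I_d -> 'M[R]_N) (B : 'I_d -> 'M[R]_D).
Variables (C : 'I_d.-1 -> 'M[R]_N) (E : 'I_d.-1 -> 'M[R]_D).

Definition fast (k : nat) (M : 'M[R]_k) : Prop :=
  computable_within (fun v : 'cV[R]_k => M *m v) (c * k%:R) /\
  computable_within (fun v : 'rV[R]_k => v *m M) (c * k%:R).

Lemma reachable_sandwich m n (M : 'M[R]_N) (M' : 'M[R]_D)
    (f : 'M[R]_(m, n) -> 'M[R]_(N, D)) s :
  fast M -> fast M' -> mx_available s f ->
  reachable (2 * c * (N * D)%:R)
    (fun t => mx_available t (fun x => M *m f x *m M')) s.
Proof.
move=> [Mc _] [_ M'c] sf.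
rewrite (_ : _ * _ = D%:R * (c * N%:R) + N%:R * (c * D%:R)); last by rewrite natrM; ring.
by apply: reachable_bind (reachable_mulmxl Mc sf) _ => u; apply: reachable_mulmxr.
Qed.

Hypotheses (fastA : forall i, fast (A i)) (fastB : forall i, fast (B i)).
Hypotheses (fastC : forall i, fast (C i)) (fastE : forall i, fast (E i)).

Lemma reachable_Ymx :
  reachable (d%:R * (2 * c * (N * D)%:R))
    (fun t => forall i, mx_available t (fun X => Ymx A B X i)) [::].
Proof.
rewrite -[d in d%:R]card_ord.
apply: reachable_forall => [i t u|i u]; first exact: mx_available_cat.
by apply: reachable_sandwich => // j k; apply: available_input.
Qed.

(** Induction on the number [k] of layers: each layer is computed once from the stored previous one,
    so the cost is linear in [k]. *)
Lemma reachable_Zrec s (k : nat) : 0 <= c ->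
  (forall i, mx_available s (fun X => Ymx A B X i)) ->
  reachable (k%:R * ((2 * c + 1) * (N * D)%:R))
    (fun t => forall i (lt_id : (i < d)%N), (i < k)%N ->
       mx_available t (fun X => Zrec A B C E X lt_id)) s.
Proof.
move=> c_ge0 sY; elim: k => [|k IHk].
  by rewrite mul0r; apply: reachable_refl.
have cost_ge0 : 0 <= (2 * c + 1) * (N * D)%:R.
  by rewrite mulr_ge0 ?ler0n // addr_ge0 // mulr_ge0.
rewrite -natr1 mulrDl mul1r; apply: reachable_bind IHk _ => u sZ.
suff: reachable ((2 * c + 1) * (N * D)%:R)
    (fun t => forall lt_kd : (k < d)%N, mx_available t (fun X => Zrec A B C E X lt_kd)) (s ++ u).
  case=> v [vb Zk]; exists v; split=> // i lt_id.
  rewrite ltnS leq_eqVlt => /predU1P[eq_ik|lt_ik]; first by subst i; apply: Zk.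
  exact/mx_available_cat/sZ.
(* Beyond the last layer nothing is left to compute. *)
have /orP[le_dk|lt_kd] : (d <= k)%N || (k < d)%N by case: ltnP.
  by apply: reachable_le (reachable_refl _) => // lt_kd; have := leq_trans lt_kd le_dk; rewrite ltnn.
suff: reachable ((2 * c + 1) * (N * D)%:R)
    (fun t => mx_available t (fun X => Zrec A B C E X lt_kd)) (s ++ u).
  (* [Zrec] takes the proof of [k < d] as an argument, but all such proofs are equal. *)
  by apply: reachable_impl => t Zk lt_kd'; rewrite (bool_irrelevance lt_kd' lt_kd).
(* Layer 0 is the first [Ymx], already available; a later layer costs two structured products and
   one multiplication per entry. *)
case: k lt_kd sZ => [|k] lt_kd sZ.
  by apply: reachable_le (reachable_refl _) => //; apply/mx_available_cat/sY.
rewrite (_ : _ * _ = 2 * c * (N * D)%:R + (N * D)%:R * 1); last by ring.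
apply: reachable_bind (reachable_sandwich (fastC _) (fastE _) (sZ _ (ltnW lt_kd) (ltnSn k))) _.
move=> v sCZE; apply: reachable_entrywise => i j w.
apply: reachable_impl (reachable_mul (available_cat w (sCZE i j)) _); last first.
  by rewrite -!catA; apply: available_cat (sY (Ordinal lt_kd) i j).
by move=> t; apply: available_ext => x; rewrite /= [in RHS]mxE.
Qed.

Lemma computable_Pmx (W : 'I_N -> 'I_D -> 'I_d -> R) (L : 'M[R]_(N, D)) :
  0 <= c ->
  computable_within (Pmx A B C E W L) ((4 * c + 3) * (N * D * d)%:R).
Proof.
move=> c_ge0.
have [s [sb sP]] : reachable ((4 * c + 3) * (N * D * d)%:R)
    (fun t => mx_available t (Pmx A B C E W L)) [::].
  (* The three summands pay for all [Ymx], for [d] layers of [Zrec], and for a sum of [d] weighted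
     terms at each entry. *)
  rewrite (_ : _ * _ = d%:R * (2 * c * (N * D)%:R)
    + (d%:R * ((2 * c + 1) * (N * D)%:R) + (N * D)%:R * (2 * d%:R))); last first.
    by rewrite (natrM _ _ d); ring.
  apply: reachable_bind reachable_Ymx _ => u sY.
  apply: reachable_bind (reachable_Zrec d c_ge0 sY) _ => v sZ.
  apply: reachable_entrywise => i j w.
  rewrite -[d in 2 * d%:R]card_ord cardT.
  apply: reachable_impl (reachable_affine _ (W i j) (L i j)
    (f := fun k x => Zmx A B C E x k i j) _) => [t|k]; last first.
    by apply: available_cat; apply: sZ.
  by apply: available_ext => x; rewrite mxE /= big_enum.
have [sigma sigmaP] := mx_available_outputs sP.
exists (Program s sigma); split=> // x.
by apply/matrixP=> i j; rewrite mxE; case: (sigmaP i j) => _ ->.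
Qed.

End Network.

(** * Parameter count and final constants *)

Lemma num_parameters_le (R : realType) (c : R) (N D d : nat)
    (a : architecture R N D d) :
  0 <= c -> (1 <= N)%N -> (1 <= D)%N -> (1 <= d)%N ->
  structured_architecture c a ->
  (num_parameters a)%:R <= (4 * c + 3) * (N * D * d)%:R.
Proof.
move=> c_ge0 N_gt0 D_gt0 d_gt0 [sA sB sC sD].
(* One bound serves all four families: [k] is [d] or [d.-1], and [l] is [N] or [D]. *)
have sum_le k (F : 'I_k -> nat) (l : nat) : (k <= d)%N -> (l <= N * D)%N ->
    (forall i, (F i)%:R <= c * l%:R) ->
    (\sum_(i < k) F i)%:R <= c * (N * D * d)%:R.
  move=> le_kd le_l Fc; rewrite natr_sum.
  apply: (@le_trans _ _ (\sum_(i < k) c * l%:R)); first exact: ler_sum.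
  rewrite sumr_const card_ord -mulrnAr -mulrnA ler_wpM2l // ler_nat.
  by rewrite leq_mul.
have le_N : (N <= N * D)%N by rewrite leq_pmulr.
have le_D : (D <= N * D)%N by rewrite leq_pmull.
have le_ND : (N * D)%:R <= (N * D * d)%:R :> R by rewrite ler_nat leq_pmulr.
have hA := sum_le _ _ _ (leqnn d) le_N (fun i => (sA i).1).
have hB := sum_le _ _ _ (leqnn d) le_D (fun i => (sB i).1).
have hC := sum_le _ _ _ (leq_pred d) le_N (fun i => (sC i).1).
have hD := sum_le _ _ _ (leq_pred d) le_D (fun i => (sD i).1).
have ND_ge0 : 0 <= (N * D * d)%:R :> R by rewrite ler0n.
(* The four families give 4cNDd, [W] gives NDd, and [L] gives ND, at most NDd. *)
by rewrite /num_parameters !natrD in hA hB hC hD *; lra.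
Qed.

(** The theorem takes an arbitrary real [c]; its sign comes from a parameter count, which is
    nonnegative and at most [c * n]. *)
Lemma structured_ge0 (R : realType) (c : R) (n : nat) (F : mxfamily R n) :
  (1 <= n)%N -> structured c F -> 0 <= c.
Proof.
move=> n_gt0 [Fc _]; rewrite -(pmulr_lge0 _ (_ : 0 < n%:R)) ?ltr0n //.
exact: le_trans (ler0n _ _) Fc.
Qed.

Lemma network_cost (R : realType) (c : R) (N D d : nat) (a : architecture R N D d) :
  (1 <= N)%N -> (1 <= D)%N -> (1 <= d)%N -> structured_architecture c a ->
  (num_parameters a)%:R <= (4 * c + 3) * (N * D * d)%:R /\
  forall th : parameters a,
    computable_within (network_map th) ((4 * c + 3) * (N * D * d)%:R).
Proof.
move=> N_gt0 D_gt0 d_gt0 sa; have [sA sB sC sD] := sa.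
(* As [d] is positive, there is a first family in [famA] to apply this to. *)
have c_ge0 := structured_ge0 N_gt0 (sA (Ordinal d_gt0)).
split; first exact: num_parameters_le.
by move=> th; apply: computable_Pmx => // i;
  [case: (sA i) | case: (sB i) | case: (sC i) | case: (sD i)] => _; apply.
Qed.

Theorem mainTheorem3 (R : realType) (c : R) :
  (exists K : R, forall (N D d : nat), (1 <= N)%N -> (1 <= D)%N -> (1 <= d)%N ->
     forall a : architecture R N D d, structured_architecture c a ->
       (num_parameters a)%:R <= K * (N * D * d)%:R /\
       forall th : parameters a,
         computable_within (network_map th) (K * (N * D * d)%:R))
  /\
  (forall d : nat, (1 <= d)%N ->
     exists K : R, forall (N D : nat), (1 <= N)%N -> (1 <= D)%N ->
     forall a : architecture R N D d, structured_architecture c a ->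
       (num_parameters a)%:R <= K * (N * D)%:R /\
       forall th : parameters a,
         computable_within (network_map th) (K * (N * D)%:R)).
Proof.
split=> [|d d_gt0].
  by exists (4 * c + 3) => N D d N_gt0 D_gt0 d_gt0 a; apply: network_cost.
(* For fixed [d], the factor [d] moves into the constant. *)
exists ((4 * c + 3) * d%:R) => N D N_gt0 D_gt0 a sa.
by rewrite -mulrA -natrM mulnC; apply: network_cost.
Qed.
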